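(* For an ordinal $\kappa$, the space $C_k(\kappa)$ is an Ascoli space if and only if $\mathrm{cf}(\kappa)\le\omega$, and in this case $C_k(\kappa)$ is complete and metrizable.
   Context: Every ordinal $\kappa$ is identified with the set of all smaller ordinals and carries the order topology generated by its natural well-order. For a Tychonoff space $X$, $C_k(X)$ is the set $C(X)$ of all continuous real-valued functions on $X$ endowed with the compact-open topology. An ordinal $\kappa$ is a successor if $\kappa=\alpha+1$ for some $\alpha$, and is limit otherwise. The cofinality $\mathrm{cf}(\kappa)$ of a limit ordinal $\kappa$ is the smallest ordinal $\alpha$ which is the order type of a cofinal subset of $\kappa$; if $\kappa$ is a successor ordinal, $\mathrm{cf}(\kappa)=1$. A subset $\mathcal{K}\subseteq C_k(Y)$ is evenly continuous if the evaluation map $Y\times\mathcal{K}\to\mathbb{R}$, $(y,f)\mapsto f(y)$, is continuous, where $\mathcal{K}$ carries the topology induced from $C_k(Y)$. A Tychonoff space $Y$ is called an Ascoli space if every compact subset $\mathcal{K}$ of $C_k(Y)$ is evenly continuous (equivalently, the natural evaluation map $Y\to C_k(C_k(Y))$ is a topological embedding). ''Complete and metrizable'' means completely metrizable, i.e. the topology is induced by a complete metric. *)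

(* Defs.v *)
From HB Require Import structures.
From mathcomp Require Import all_boot all_order all_algebra.
From mathcomp Require Import wochoice.
From mathcomp Require Import all_classical all_reals all_analysis.

Set Implicit Arguments.
Unset Strict Implicit.
Unset Printing Implicit Defensive.

Import Order.TTheory GRing.Theory Num.Theory.
Import numFieldTopology.Exports.

Local Open Scope classical_set_scope.
Local Open Scope ring_scope.

(* An ordinal is represented by a well-ordered type, playing the role of the
   set of all smaller ordinals; the elements x : alpha are the ordinals
   smaller than alpha, x being identified with [set y | y < x]. *)
Record ordnum := Ordnum {
  ord_disp : Order.disp_t;
  ord_sort :> orderType ord_disp;
  ord_wo : well_order (<=%O : rel ord_sort) }.

(* alpha <= beta: alpha is order-isomorphic to an initial segment of beta. *)
Definition ord_le (alpha beta : ordnum) : Prop :=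
  exists f : alpha -> beta, {mono f : x y / (x <= y)%O} /\
    forall (x : alpha) (b : beta), (b <= f x)%O -> range f b.

Definition order_type (kappa : ordnum) (A : set kappa) (alpha : ordnum) : Prop :=
  exists f : alpha -> kappa,
    {mono f : x y / (x <= y)%O} /\ range f = A.

(* kappa = a + 1, with a + 1 the von Neumann successor of a: the union of
   (the set identified with) a and the singleton of a. *)
Definition is_successor (kappa : ordnum) : Prop :=
  exists a : kappa, [set: kappa] = [set x | (x < a)%O] `|` [set a].

Definition cofinal (kappa : ordnum) (A : set kappa) : Prop :=
  forall x : kappa, exists2 y, A y & (x <= y)%O.

Definition cofinal_type (kappa alpha : ordnum) : Prop :=
  exists A : set kappa, cofinal A /\ order_type A alpha.

Lemma wo_nat : well_order (<=%O : rel nat).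
Proof.
apply: antisymmetric_well_order => [|A [x Ax]]; first exact: le_anti.
have exA : exists n, n \in A by exists x.
case: (ex_minnP exA) => n An nmin; by exists n; split.
Qed.

Lemma wo_I1 : well_order (<=%O : rel 'I_1).
Proof.
apply: antisymmetric_well_order => [|A [x Ax]]; first exact: le_anti.
by exists x; split => // y; rewrite (ord1 x) (ord1 y).
Qed.

Definition omega : ordnum := Ordnum wo_nat.
Definition ordone : ordnum := Ordnum wo_I1.

Section cofinality_exists.

Lemma ord_min (alpha : ordnum) (P : set alpha) : P !=set0 ->
  exists2 a, P a & forall b, P b -> (a <= b)%O.
Proof.
move=> [x Px]; have [|a [[aP amin] _]] := @ord_wo alpha (mem P).
  by exists x; rewrite inE.
exists a; first by move: aP; rewrite inE.
by move=> b Pb; apply: amin; rewrite inE.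
Qed.

Lemma ord_wf (alpha : ordnum) : well_founded (fun x y : alpha => (x < y)%O).
Proof.
move=> x; apply: contrapT => nx.
have [a na amin] := ord_min (ex_intro (fun x => ~ Acc _ x) x nx).
apply: na; constructor => y ya; apply: contrapT => /amin.
by rewrite leNgt ya.
Qed.

Lemma mono_ord_le (alpha kappa : ordnum) (f : alpha -> kappa) :
  {mono f : x y / (x <= y)%O} -> ord_le alpha kappa.
Proof.
move=> fm; have fs := leW_mono fm.
pose step (x : alpha) (c : forall y, (y < x)%O -> kappa) : kappa :=
  xget (f x) [set k | (forall y (h : (y < x)%O), (c y h < k)%O) /\
    forall k', (forall y (h : (y < x)%O), (c y h < k')%O) -> (k <= k')%O].
pose c := Fix (@ord_wf alpha) (fun=> kappa : Type) step.
have cE x : c x = step x (fun y _ => c y).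
  apply: (Fix_eq (@ord_wf alpha) (fun=> kappa : Type) step) => y g h gh.
  congr step; apply/functional_extensionality_dep => z.
  by apply/functional_extensionality_dep.
have cP x : (c x <= f x)%O /\ (forall y, (y < x)%O -> (c y < c x)%O) /\
    forall k', (forall y, (y < x)%O -> (c y < k')%O) -> (c x <= k')%O.
  elim/(well_founded_ind (@ord_wf alpha)): x => x IH.
  have fxP y : (y < x)%O -> (c y < f x)%O.
    by move=> yx; rewrite (le_lt_trans (IH y yx).1)// fs.
  have [k kP kmin] := ord_min (ex_intro
    (fun k : kappa => forall y, (y < x)%O -> (c y < k)%O) (f x) fxP).
  rewrite cE /step; case: xgetP => [k' _ [k'P k'min]|/(_ k)/=]; last first.
    by case.
  by split; [exact: k'min|].
have cs : {homo c : x y / (x < y)%O} by move=> x y; exact: (cP y).2.1.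
exists c; split; first exact: le_mono.
move=> x b; elim/(well_founded_ind (@ord_wf alpha)): x => x IH.
rewrite le_eqVlt => /predU1P[->|bx]; first by exists x.
have [y yx by_] : exists2 y, (y < x)%O & (b <= c y)%O.
  apply: contrapT => nex; move: bx; rewrite ltNge => /negP; apply.
  apply: (cP x).2.2 => y yx; rewrite ltNge; apply/negP => by_.
  by apply: nex; exists y.
exact: (IH y).
Qed.

Lemma cofinality_exists (kappa : ordnum) : exists alpha : ordnum,
  cofinal_type kappa alpha /\
  forall beta : ordnum, cofinal_type kappa beta -> ord_le alpha beta.
Proof.
have inv (alpha beta : ordnum) (f : alpha -> kappa) (g : beta -> kappa) :
    {mono f : x y / (x <= y)%O} ->
    {mono g : x y / (x <= y)%O} ->
    range f `<=` range g -> ord_le alpha beta.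
  move=> fm gm fg.
  have /choice[h hE] x : exists y, g y = f x.
    by have [|y _ <-] := fg (f x); [exists x|exists y].
  by apply: (@mono_ord_le _ _ h) => x y; rewrite -gm !hE fm.
pose S := [set a : kappa | exists beta, cofinal_type kappa beta /\
  exists f : beta -> kappa, {mono f : x y / (x <= y)%O} /\
    range f = [set x | (x < a)%O]].
have seg beta : cofinal_type kappa beta ->
    exists f : beta -> kappa, {mono f : x y / (x <= y)%O} /\
      (range f = setT \/ exists2 a, S a & range f = [set x | (x < a)%O]).
  move=> bk; have [A [_ [g [/mono_ord_le[f [fm fi]] _]]]] := bk.
  exists f; split => //.
  have [[x nx]|nx] := pselect (~` range f !=set0); last first.
    left; apply/seteqP; split => // x _; apply: contrapT => fx.
    by apply: nx; exists x.
  right.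
  have [a na amin] := ord_min (ex_intro (~` range f) x nx).
  have fE : range f = [set x | (x < a)%O].
    apply/seteqP; split => [_ [y _ <-]/=|y /= ya].
      by rewrite ltNge; apply/negP => /fi.
    by apply: contrapT => /amin; rewrite leNgt ya.
  by exists a => //; exists beta; split => //; exists f.
have [S0|S0] := pselect (S !=set0).
  have [a [alpha [ak [f [fm fE]]]] amin] := ord_min S0.
  exists alpha; split => // beta /seg[g [gm gE]].
  apply: (inv _ _ f g) => //.
  case: gE => [->//|[b Sb ->]]; rewrite fE => x /= xa.
  exact: lt_le_trans (amin _ Sb).
exists kappa; split.
  exists setT; split; first by move=> x; exists x.
  by exists id; split => //; apply/seteqP; split => // x _; exists x.
move=> beta /seg[g [gm gE]]; apply: (inv _ _ id g) => //.
by case: gE => [->//|[b Sb]]; case: S0; exists b.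
Qed.

End cofinality_exists.

(* 0 is a limit ordinal, with cofinality 0. *)
Definition cofinality (kappa : ordnum) : ordnum :=
  if pselect (is_successor kappa) then ordone
  else projT1 (cid (cofinality_exists kappa)).

Section function_spaces.
Context {R : realType}.

Definition Ck (X : topologicalType) : topologicalType :=
  initial_topology (id : continuousType X R -> {compact-open, X -> R}).

(* The library phrases complete regularity through uniformities; by
   uniform_separatorP this is separation by real-valued functions. *)
Definition tychonoff_space (Y : topologicalType) : Prop :=
  completely_regular_space Y /\ hausdorff_space Y.

Definition evenly_continuous (Y : topologicalType) (K : set (Ck Y)) : Prop :=
  continuous (fun p : Y * K => (set_val p.2 : continuousType Y R) p.1).

Definition ascoli_space (Y : topologicalType) : Prop :=
  tychonoff_space Y /\
  forall K : set (Ck Y), compact K -> evenly_continuous K.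

Definition is_metric (T : Type) (d : T -> T -> R) : Prop :=
  [/\ forall x y, 0 <= d x y,
      forall x y, d x y = 0 <-> x = y,
      forall x y, d x y = d y x &
      forall x y z, d x z <= d x y + d y z].

Definition induces_topology (T : topologicalType) (d : T -> T -> R) : Prop :=
  forall (x : T) (A : set T),
    nbhs x A <-> exists2 e : R, 0 < e & [set y | d x y < e] `<=` A.

Definition complete_metric (T : Type) (d : T -> T -> R) : Prop :=
  forall u : nat -> T,
    (forall e : R, 0 < e -> \forall m & n \near \oo, d (u m) (u n) < e) ->
    exists l : T, (fun n => d (u n) l) @ \oo --> (0 : R).

Definition completely_metrizable (T : topologicalType) : Prop :=
  exists d : T -> T -> R,
    [/\ is_metric d, induces_topology d & complete_metric d].

End function_spaces.

Arguments Ck : clear implicits.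
Arguments ascoli_space : clear implicits.
Arguments completely_metrizable : clear implicits.

(* Main.v *)
Require Import Defs.
From mathcomp Require Import all_boot all_order all_algebra.
From mathcomp Require Import all_classical all_reals all_analysis.
From mathcomp Require Import lra.

(** If kappa has cofinality at most omega, it is covered by the interiors of
    countably many compact sets C_n: one set if kappa is a successor, the
    initial segments [0, a_n] along a cofinal sequence otherwise.  For any such
    space the compact-open topology is that of the complete metric
      d(f, g) = sup_x min (w x) |f x - g x|,   w x = 1 / (1 + min {n | C_n x}):
    a d-ball controls f only where w is not small, that is on a compact set,
    while every compact set lies where w is bounded below
    (Ck_completely_metrizable).  A metrizable space Y is Ascoli
    (metrizable_ascoli): a compact set of functions in C_k(Y) is equicontinuous
    on every compact set (compact_Ck_equicontinuous), in particular along every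
    convergent sequence, hence equicontinuous.

    Conversely, let kappa have uncountable cofinality; then kappa has no
    largest element and every increasing sequence is bounded.  The functionals
      jump a : f |-> f (a + 1) - f a
    on C_k(kappa) tend to 0 uniformly on each compact Q: if infinitely many of
    them were of size at least e somewhere on Q, infinitely many of these would
    lie below some b < kappa and accumulate at the least such b, against the
    equicontinuity of Q at b (large_jumps_finite).  So the jumps and 0 form a
    compact set in C_k(C_k(kappa)).  Evaluation is not continuous on it at the
    pair (0, 0): a neighbourhood of 0 in C_k(kappa) constrains functions on a
    bounded set only, so it contains the indicator of ]b, kappa[ for all large
    b, on which jump b takes the value 1, although all but finitely many jumps
    lie in any given neighbourhood of 0 (jumps_not_evenly_continuous). *)

Set Implicit Arguments.
Unset Strict Implicit.
Unset Printing Implicit Defensive.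

Import Order.TTheory GRing.Theory Num.Theory.
Import numFieldTopology.Exports numFieldNormedType.Exports.

Local Open Scope classical_set_scope.
Local Open Scope ring_scope.

(** * Neighbourhoods and compact sets in C_k(X) *)

Definition ckfun (R : realType) (X : topologicalType) (f : Ck R X) : X -> R :=
  (f : continuousType X R).

Section Ck_nbhs.
Context {R : realType} {X : topologicalType}.
Implicit Types (S : set X) (f g : Ck R X) (e : R).

Lemma ckfun_continuous f : continuous (ckfun f).
Proof. exact: cts_fun. Qed.

Lemma ckfunP f g : ckfun f =1 ckfun g -> f = g.
Proof. by move=> fg; apply/continuousEP. Qed.

Definition tube S f e : set (Ck R X) :=
  [set g | forall x, S x -> `|ckfun g x - ckfun f x| < e].

Lemma tube_nbhs S f e : compact S -> 0 < e -> nbhs f (tube S f e).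
Proof.
move=> cS e0.
have fc := @ckfun_continuous f.
have := @initial_continuous (continuousType X R) {compact-open, X -> R} id f.
move=> /(iffLR (compact_open_fam_compactP (f := ckfun f) (F := nbhs f) fc _)).
have := @fam_nbhs X R compact S [set p | ball p.1 e p.2] (ckfun f).
move=> /(_ _ cS) fn /(_ _ (fn (entourage_ball _ (PosNum e0)))).
apply: filterS => g gf x Sx; rewrite distrC; exact: gf.
Qed.

(** A subbasic condition, that f maps a compact K into an open W, already
    follows from closeness to f on K: by compactness of K there is a radius,
    common to all x in K, for which the balls around f x lie in W. *)
Lemma nbhs_tube f (A : set (Ck R X)) : nbhs f A ->
  exists S e, [/\ compact S, 0 < e & tube S f e `<=` A].
Proof.
rewrite nbhsE => -[_ [ [V oV <-] Vf] VA].
pose F : set_system {compact-open, X -> R} := filter_from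
  [set p : set X * R | compact p.1 /\ 0 < p.2]
  (fun p => [set h | forall x, p.1 x -> `|h x - ckfun f x| < p.2]).
have FF : Filter F.
  apply: filter_from_filter; first by exists (set0, 1); split=> //;
    exact: compact0.
  move=> [S e] [S' e'] /= [cS e0] [cS' e'0].
  exists (S `|` S', Num.min e e') => /=.
    by split; [exact: compactU|rewrite lt_min e0].
  by move=> h hS; split=> x Sx; have := hS x; rewrite lt_min => /(_ _)/andP[]//;
    [left|right].
have Ff : F --> (ckfun f : {compact-open, X -> R}).
  apply/compact_open_cvgP => K W cK oW fKW.
  have : \forall e \near 0^'+,
      K `<=` [set x | forall r : R, `|r - ckfun f x| < e -> W r].
    move/compact_near_coveringP : cK; apply => x Kx.
    have /nbhs_ballP[e /= e0 eW] : nbhs (ckfun f x) W.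
      by apply: open_nbhs_nbhs; split => //; apply: fKW; exists x.
    exists ([set x' | ball (ckfun f x) (e / 2) (ckfun f x')],
            [set t | t < e / 2]) => /=.
      split; last by apply: nbhs_right_lt; lra.
      by apply: ckfun_continuous; apply: nbhsx_ballx; lra.
    move=> [x' t] /= [x'x te] r rx; apply: eW.
    rewrite /ball /= in x'x *.
    have := ler_distD (ckfun f x') (ckfun f x) r.
    rewrite (distrC (ckfun f x') r); lra.
  case=> e /= e0 eK.
  (* [eK] holds for the radii strictly below [e], whence the half *)
  exists (K, e / 2) => /=; first by split => //; lra.
  move=> h hK _ [x Kx <-]; apply: (eK (e / 2) _ _ x Kx); last exact: hK.
    by rewrite /= sub0r normrN gtr0_norm; lra.
  lra.
have [ [S e] [/= cS e0] SeV] : F V by apply: Ff; apply: open_nbhs_nbhs.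
exists S, e; split => // g gS; apply: VA; exact: SeV.
Qed.

Lemma ckeval_continuous (x : X) : continuous (fun f => ckfun f x).
Proof.
move=> f V /nbhs_ballP[e /= e0 eV].
apply: filterS (tube_nbhs f (@compact_set1 _ x) e0) => g /(_ x erefl) gf.
by apply: eV; rewrite /ball /= distrC.
Qed.

(** Near f the values at y and at the points x of S are controlled
    simultaneously by a tube around f, and finitely many such f suffice for K.
    Used below with S a compact neighbourhood of y, and with S a sequence
    converging to y together with y. *)
Lemma compact_Ck_equicontinuous (K : set (Ck R X)) S (y : X) e :
  compact K -> compact S -> S y -> 0 < e ->
  \forall x \near y, S x -> forall f, K f -> `|ckfun f x - ckfun f y| < e.
Proof.
move=> cK cS Sy e0.
have : \forall x \near y, K `<=` [set f | S x -> `|ckfun f x - ckfun f y| < e].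
  move/compact_near_coveringP : cK; apply => f Kf.
  have e3 : 0 < e / 3 by lra.
  exists (tube S f (e / 3), [set x | ball (ckfun f y) (e / 3) (ckfun f x)]).
    split; first exact: tube_nbhs.
    by apply: ckfun_continuous; exact: nbhsx_ballx.
  move=> [g x] /= [gf xy] Sx; rewrite /ball /= in xy.
  have := gf _ Sx; have := gf _ Sy.
  have := ler_distD (ckfun f x) (ckfun g x) (ckfun g y).
  have := ler_distD (ckfun f y) (ckfun f x) (ckfun g y).
  rewrite (distrC (ckfun f y) (ckfun g y)) (distrC (ckfun f x) (ckfun f y)).
  lra.
by apply: filterS => x xK Sx f Kf; exact: xK.
Qed.

End Ck_nbhs.

(** * Metrizable spaces are Ascoli *)

(** A filter on S that does not cluster at y avoids a neighbourhood of y, so it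
    lives on a finite set.  This covers both a convergent sequence with its
    limit and the one-point compactification of a discrete set. *)
Lemma compact_almost_in_nbhs (T : topologicalType) (S : set T) (y : T) :
  S y -> (forall U, nbhs y U -> finite_set (S `\` U)) -> compact S.
Proof.
move=> Sy Sfin F PF FS.
have [Fy|nFy] := pselect (cluster F y); first by exists y.
have [A [U [FA yU AU]]] : exists A U, [/\ F A, nbhs y U & ~ (A `&` U !=set0)].
  apply: contrapT => nAU; apply: nFy => A U FA yU.
  by apply: contrapT => AU; apply: nAU; exists A, U.
have /finite_compact/(_ F PF) [|x [[Sx _] Fx]] := Sfin U yU; last by exists x.
apply: filterS (filterI FA FS) => x [Ax Sx]; split => // Ux.
by apply: AU; exists x.
Qed.

Section metrizable.
Context {R : realType} {Y : topologicalType} {d : Y -> Y -> R}.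
Hypotheses (dm : is_metric d) (dt : induces_topology d).

Lemma metric_nbhs y e : 0 < e -> nbhs y [set z | d y z < e].
Proof. by move=> e0; apply/dt; exists e. Qed.

Lemma metrizable_tychonoff : tychonoff_space Y.
Proof.
have [d0 dE dC dT] := dm.
split=> [a B cB nBa|p q pq]; last first.
  apply/dE/eqP; rewrite eq_le d0 andbT leNgt; apply/negP => dpq.
  have e0 : 0 < d p q / 2 by lra.
  have [z [/= pz qz]] := pq _ _ (metric_nbhs p e0) (metric_nbhs q e0).
  have := dT p z q; rewrite (dC z q); lra.
have : nbhs a (~` B).
  by apply: open_nbhs_nbhs; split => //; rewrite openC.
move=> /dt[e e0 eB].
apply/(@uniform_separatorP _ R); exists (fun y => Num.min 1 (d a y / e)).
have f0 y : 0 <= d a y / e by rewrite divr_ge0// ltW.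
split=> [y W /nbhs_ballP[t /= t0 tW]|_ [y _ <-]|_ [_ -> <-]|_ [y By <-]] /=.
- have te : 0 < t * e by rewrite mulr_gt0.
  apply: filterS (metric_nbhs y te) => z /= yz; apply: tW; rewrite /ball /=.
  have yz' : d y z / e < t by rewrite ltr_pdivrMr.
  have h1 : d a y / e <= d a z / e + d y z / e.
    by rewrite -mulrDl ler_pM2r ?invr_gt0// (dC y z).
  have h2 : d a z / e <= d a y / e + d y z / e.
    by rewrite -mulrDl ler_pM2r ?invr_gt0.
  rewrite ltr_norml; move: h1 h2 yz'.
  set u := d a y / e; set v := d a z / e; set w := d y z / e => h1 h2 yz'.
  by rewrite /Num.min; case: ifP; case: ifP; rewrite ?ltNge => /negP + /negP;
    lra.
- by rewrite in_itv /= le_min f0 ler01 /= ge_min lexx.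
- by rewrite ((dE a a).2 erefl) mul0r min_r.
- rewrite min_l // ler_pdivlMr// mul1r leNgt; apply/negP => /eB; exact.
Qed.

(** Were K not equicontinuous at y, there would be points x n tending to y at
    which K violates equicontinuity for a fixed e; but K is equicontinuous
    along the compact set made of y and the x n. *)
Lemma metrizable_ascoli : ascoli_space R Y.
Proof.
split; first exact: metrizable_tychonoff.
have [d0 dE dC dT] := dm.
move=> K cK [y [f Kf]] W /nbhs_ballP[e /= e0 eW].
have e2 : 0 < e / 2 by lra.
have [r r0 rK] : exists2 r, 0 < r & forall x, d y x < r ->
    forall g, K g -> `|ckfun g x - ckfun g y| < e / 2.
  apply: contrapT => nr.
  have /choice[x xP] (n : nat) : exists x, d y x < n.+1%:R^-1 /\
      ~ forall g, K g -> `|ckfun g x - ckfun g y| < e / 2.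
    apply: contrapT => nx; apply: nr.
    exists n.+1%:R^-1; first by rewrite invr_gt0.
    by move=> x yx; apply: contrapT => xK; apply: nx; exists x.
  have xy U : nbhs y U -> \forall n \near \oo, U (x n).
    move=> /dt[t t0 tU].
    near=> n; apply: tU => /=; apply: lt_trans (xP n).1 _.
    by near: n; exact: (near_infty_natSinv_lt (PosNum t0)).
  pose S := y |` range x.
  have cS : compact S.
    apply: (@compact_almost_in_nbhs _ _ y); first by left.
    move=> U yU; have [N _ NU] := xy U yU.
    apply: (sub_finite_set (B := x @` `I_N)); last exact/finite_image/finite_II.
    move=> _ [[->|[n _ <-]] nU]; first by case: nU; exact: nbhs_singleton.
    by exists n => //=; rewrite ltnNge; apply/negP => /NU.
  have [N _ /(_ N (leqnn N)) xN] :=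
    xy _ (compact_Ck_equicontinuous cK cS (or_introl erefl) e2).
  by apply: (xP N).2; apply: xN; right; exists N.
have /(@initial_continuous K (Ck R Y) set_val (exist _ f Kf)) fy :
  nbhs f (tube [set y] f (e / 2)).
  by apply: tube_nbhs => //; exact: compact_set1.
exists ([set x | d y x < r], set_val @^-1` tube [set y] f (e / 2)).
  by split; [exact: metric_nbhs|exact: fy].
move=> [x [g Kg]] /= [yx gf]; apply: eW; rewrite /ball /=.
have := gf y erefl; have := rK x yx g (set_mem Kg).
rewrite /= set_valE /=.
have := ler_distD (ckfun g y) (ckfun f y) (ckfun g x).
rewrite (distrC (ckfun f y) (ckfun g y)) (distrC (ckfun g y) (ckfun g x)).
rewrite /ckfun; lra.
Unshelve. all: by end_near. Qed.

End metrizable.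

(** * Complete metrizability of C_k(X) for locally compact sigma-compact X *)

Section weighted_metric.
Context {R : realType} {X : topologicalType}.
Variable w : X -> R.
Hypotheses (w_gt0 : forall x, 0 < w x) (w_le1 : forall x, w x <= 1).
(** Under the next two hypotheses a set lies in a compact one exactly when w is
    bounded away from 0 on it. *)
Hypothesis w_local : forall x : X,
  exists2 t, 0 < t & \forall y \near x, t <= w y.
Hypothesis w_proper : forall t, 0 < t ->
  exists2 K, compact K & forall x, t <= w x -> K x.
Implicit Types f g h : Ck R X.

(** The point 0 keeps the supremum meaningful when X is empty. *)
Definition wdist f g : R :=
  sup (0 |` range (fun x => Num.min (w x) `|ckfun f x - ckfun g x|)).

Let wdist_has_sup f g : has_sup
  (0 |` range (fun x => Num.min (w x) `|ckfun f x - ckfun g x|)).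
Proof.
split; first by exists 0; left.
by exists 1 => _ [->|[x _ <-]]; rewrite ?ler01// ge_min w_le1.
Qed.

Lemma wdist_ge0 f g : 0 <= wdist f g.
Proof. by apply: ub_le_sup; [exact: (wdist_has_sup f g).2|left]. Qed.

Lemma wdistP f g e : 0 <= e ->
  wdist f g <= e <-> forall x, Num.min (w x) `|ckfun f x - ckfun g x| <= e.
Proof.
move=> e0; split=> [fge x|fge].
  apply: le_trans fge; apply: ub_le_sup; first exact: (wdist_has_sup f g).2.
  by right; exists x.
apply: ge_sup; first exact: (wdist_has_sup f g).1.
by move=> _ [->//|[x _ <-]].
Qed.

Lemma wdist_lt_ckfun f g e x : wdist f g < e -> e <= w x ->
  `|ckfun f x - ckfun g x| < e.
Proof.
move=> fge ew; have := (iffLR (wdistP _ _ (wdist_ge0 f g)) (lexx _)) x.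
move=> /le_lt_trans/(_ fge); rewrite gt_min => /orP[|//].
by rewrite ltNge ew.
Qed.

Lemma wdist_le_ckfun f g e : 0 <= e ->
  (forall x, e <= w x -> `|ckfun f x - ckfun g x| <= e) -> wdist f g <= e.
Proof.
move=> e0 fge; apply/(wdistP _ _ e0) => x; rewrite ge_min.
by have [/fge ->|/ltW ->] := leP e (w x); rewrite ?orbT.
Qed.

Lemma wdist_metric : is_metric wdist.
Proof.
split.
- exact: wdist_ge0.
- move=> f g; split=> [fg0|->]; last first.
    apply/eqP; rewrite eq_le wdist_ge0 andbT.
    apply/(wdistP g g (lexx (0 : R))) => x.
    by rewrite subrr normr0 ge_min lexx orbT.
  apply: ckfunP => x; apply/eqP; rewrite -subr_eq0 -normr_le0.
  have := (iffLR (wdistP f g (lexx 0))); rewrite fg0 => /(_ (lexx 0) x).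
  by rewrite ge_min leNgt w_gt0.
- move=> f g; by rewrite /wdist; under eq_fun do rewrite distrC.
- move=> f g h.
  apply/(wdistP _ _ (addr_ge0 (wdist_ge0 f g) (wdist_ge0 g h))) => x.
  have := (iffLR (wdistP f g (wdist_ge0 f g)) (lexx _)) x.
  have := (iffLR (wdistP g h (wdist_ge0 g h)) (lexx _)) x.
  have := ler_distD (ckfun g x) (ckfun f x) (ckfun h x).
  have := normr_ge0 (ckfun f x - ckfun g x).
  have := normr_ge0 (ckfun g x - ckfun h x).
  have := w_gt0 x.
  rewrite !ge_min => ? ? ? ? /orP[] ? /orP[] ?; apply/orP; lra.
Qed.

(** Every compact set lies in some {w >= t}, and conversely {w >= e / 2} lies
    in a compact set, outside of which the bound min (w x) _ < e / 2 is free. *)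
Lemma wdist_topology : induces_topology wdist.
Proof.
move=> f A; split=> [/nbhs_tube[S [e [cS e0 SA]]]|[e e0 eA]].
  have : \forall t \near 0^'+, S `<=` [set x | t <= w x].
    move/compact_near_coveringP : cS; apply => x Sx.
    have [t t0 tw] := w_local x.
    exists ([set y | t <= w y], [set s | s <= t]) => /=.
      by split => //; exact: nbhs_right_le.
    by move=> [y s] /= [ty st]; exact: le_trans ty.
  case=> t /= t0 tS.
  have t2 : 0 < t / 2 by lra.
  have Sw x : S x -> t / 2 <= w x.
    by apply: tS => //; rewrite /= sub0r normrN gtr0_norm; lra.
  exists (Num.min (t / 2) e); first by rewrite lt_min t2.
  move=> g /= fg; apply: SA => x Sx; rewrite distrC.
  apply: (@lt_le_trans _ _ (Num.min (t / 2) e)); last first.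
    by rewrite ge_min lexx orbT.
  by apply: wdist_lt_ckfun => //; rewrite ge_min Sw.
have e2 : 0 < e / 2 by lra.
have [K cK wK] := w_proper e2.
apply: filterS (tube_nbhs f cK e2) => g gf; apply: eA => /=.
apply: (@le_lt_trans _ _ (e / 2)); last lra.
apply: wdist_le_ckfun; first exact: ltW.
by move=> x /wK/gf; rewrite distrC => /ltW.
Qed.

(** A Cauchy sequence converges uniformly on each set {w >= e}; since w is
    bounded below near every point, the limit is continuous. *)
Lemma wdist_complete : complete_metric wdist.
Proof.
move=> u uC.
have {}uC e : 0 < e ->
    exists N, forall m n, (N <= m)%N -> (N <= n)%N -> wdist (u m) (u n) < e.
  move=> /uC[[A B] [/= [N _ NA] [M _ MB]] AB].
  exists (maxn N M) => m n; rewrite !geq_max => /andP[Nm _] /andP[_ Mn].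
  by apply: (AB (m, n)); split; [exact: NA|exact: MB].
have cv x : cvgn (fun n => ckfun (u n) x).
  apply: cauchy_cvg; apply/cauchyP => e e0.
  have [|N uN] := uC (Num.min e (w x)); first by rewrite lt_min e0 w_gt0.
  exists (ckfun (u N) x); exists N => // n /= Nn; rewrite /ball /=.
  apply: (@lt_le_trans _ _ (Num.min e (w x))); last by rewrite ge_min lexx.
  apply: wdist_lt_ckfun; last by rewrite ge_min lexx orbT.
  exact: uN.
pose l x := limn (fun n => ckfun (u n) x).
have ul e : 0 < e -> exists N, forall n x, (N <= n)%N -> e <= w x ->
    `|ckfun (u n) x - l x| <= e.
  move=> /uC[N uN]; exists N => n x Nn ew.
  have cvn : (fun m => `|ckfun (u n) x - ckfun (u m) x|) @ \oo -->
      `|ckfun (u n) x - l x|.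
    by apply: cvg_norm; apply: cvgB; [exact: cvg_cst|exact: cv].
  apply: (cvgr_to_le cvn).
  by exists N => // m /= Nm; apply/ltW/wdist_lt_ckfun => //; exact: uN.
have lc : continuous l.
  move=> x V /nbhs_ballP[e /= e0 eV].
  have [t t0 tw] := w_local x.
  have [|N uN] := ul (Num.min t (e / 4)); first by rewrite lt_min t0; lra.
  have e4 : 0 < e / 4 by lra.
  have uNx : \forall y \near x, ball (ckfun (u N) x) (e / 4) (ckfun (u N) y).
    by apply: ckfun_continuous; exact: nbhsx_ballx.
  apply: filterS (filterI tw uNx) => y [ty yx]; apply: eV.
  have tx := nbhs_singleton tw.
  have le4 z : t <= w z -> `|ckfun (u N) z - l z| <= e / 4.
    move=> tz; apply: (@le_trans _ _ (Num.min t (e / 4))).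
      by apply: uN => //; rewrite ge_min tz.
    by rewrite ge_min lexx orbT.
  have := le4 y ty; have := le4 x tx; rewrite /ball /= in yx *.
  have := ler_distD (ckfun (u N) x) (l x) (l y).
  have := ler_distD (ckfun (u N) y) (ckfun (u N) x) (l y).
  rewrite (distrC (l x) (ckfun _ _)); lra.
exists (mkcts lc : Ck R X); apply/cvgrPdist_le => e e0.
have [N uN] := ul e e0; exists N => // n /= Nn.
rewrite sub0r normrN ger0_norm ?wdist_ge0//.
apply: wdist_le_ckfun => [|x ew]; first exact: ltW.
exact: uN.
Qed.

End weighted_metric.

(** The weight of x is determined by the first C n containing it, so a set
    where the weight is bounded below is covered by finitely many C n. *)
Lemma Ck_completely_metrizable (R : realType) (X : topologicalType)
    (C : nat -> set X) : (forall n, compact (C n)) ->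
  (forall x : X, exists n, nbhs x (C n)) -> completely_metrizable R (Ck R X).
Proof.
move=> cC nC.
have /choice[rk rkP] x : exists n, C n x /\ forall m, C m x -> (n <= m)%N.
  have exC : exists n, `[< C n x >].
    by have [n /nbhs_singleton Cn] := nC x; exists n; apply/asboolP.
  by case: (ex_minnP exC) => n /asboolP Cn nmin; exists n; split => // m Cm;
    apply: nmin; apply/asboolP.
pose w x : R := (rk x).+1%:R^-1.
have w0 x : 0 < w x by rewrite invr_gt0.
have w1 x : w x <= 1 by rewrite invf_le1// ler1n.
have wl (x : X) : exists2 t, 0 < t & \forall y \near x, t <= w y.
  have [n Cn] := nC x; exists (n.+1%:R^-1); first by rewrite invr_gt0.
  apply: filterS Cn => y Cny; rewrite lef_pV2 ?posrE// ler_nat ltnS.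
  exact: (rkP y).2.
have wp t : 0 < t -> exists2 K, compact K & forall x, t <= w x -> K x.
  move=> t0.
  have [N _ /(_ N (leqnn N))/= Nt] := near_infty_natSinv_lt (PosNum t0).
  exists (\big[setU/set0]_(i < N) C i); first exact: bigsetU_compact.
  move=> x tx; rewrite -bigcup_mkord; exists (rk x); last exact: (rkP x).1.
  have := lt_le_trans Nt tx.
  by rewrite ltf_pV2 ?posrE// ltr_nat ltnS.
exists (wdist w); split; first exact: wdist_metric.
  exact: wdist_topology.
exact: wdist_complete.
Qed.

(** * The order topology of an ordinal *)

Section ordinal_topology.
Context {kappa : ordnum}.
Local Notation X := (order_topology kappa).
Implicit Types a b c x y : kappa.

Definition segment a : set X := [set y | (y <= a)%O].

Lemma ord_succ_exists a : (exists b, (a < b)%O) ->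
  exists2 s, (a < s)%O & forall x, (x < s)%O = (x <= a)%O.
Proof.
move=> /(@ord_min kappa [set b | (a < b)%O])[s /= as_ smin]; exists s => // x.
apply/idP/idP => [|/le_lt_trans->//]; rewrite leNgt.
by apply: contraTN => /smin; rewrite leNgt.
Qed.

Lemma segment_clopen a : clopen (segment a).
Proof.
split; last by have := @lray_closed _ X a; rewrite set_itvE.
have [/ord_succ_exists[s _ sE]|na] := pselect (exists b, (a < b)%O).
  have := @lray_open _ X s; rewrite set_itvE; congr open.
  by apply/seteqP; split => x /=; rewrite sE.
rewrite (_ : segment a = setT); first exact: openT.
apply/seteqP; split => // x _ /=; rewrite /segment /= leNgt; apply/negP => ax.
by apply: na; exists x.
Qed.

Lemma segment_nbhs a x : (x <= a)%O -> nbhs (x : X) (segment a).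
Proof.
by move=> xa; apply: open_nbhs_nbhs; split; [exact: (segment_clopen a).1|].
Qed.

(** An ordinal has a neighbourhood base of half-open intervals ]c, x]; the
    first alternative is what remains of it at 0. *)
Lemma nbhs_left_itv x (U : set X) : nbhs (x : X) U ->
  (segment x `<=` U) \/
  exists2 c, (c < x)%O & forall y, (c < y)%O -> (y <= x)%O -> U y.
Proof.
rewrite itv_nbhsE => -[[[b c|[]] r] [oi xi] iU]; last by case: r oi xi iU.
  have ? := itv_open_ends_lside oi; subst b.
  move: xi; rewrite itv_boundlr => /andP[cx xr].
  right; exists c => [|y cy yx]; first by rewrite bnd_simp in cx.
  apply: iU; rewrite /= itv_boundlr bnd_simp cy /=.
  by apply: le_trans xr; rewrite bnd_simp.
left => y yx; apply: iU; rewrite /= itv_boundlr /=.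
move: xi; rewrite itv_boundlr /= => xr.
by apply: le_trans xr; rewrite bnd_simp.
Qed.

(** A filter on [0, a] clusters at the least x such that [0, x] belongs to it:
    a set of the filter missing some ]c, x] would put [0, c] in the filter. *)
Lemma initial_segment_compact a : compact (segment a).
Proof.
move=> F PF Fa.
have [x Fx xmin] := @ord_min kappa [set x | F (segment x)] (ex_intro _ a Fa).
exists x; split; first exact: xmin.
move=> A U FA /nbhs_left_itv[xU|[c cx cU]].
  have [y [Ay yx]] := filter_ex (filterI FA Fx).
  by exists y; split => //; exact: xU.
apply: contrapT => AU; have : F (segment c).
  apply: filterS (filterI FA Fx) => y [Ay yx]; rewrite /segment /= leNgt.
  by apply/negP => cy; apply: AU; exists y; split => //; exact: cU.
by move/xmin; rewrite leNgt cx.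
Qed.

(** The open initial segments cover kappa and are increasing, so one of them
    contains a given compact set; [x0] rules out the empty ordinal, which has
    no segment of the form [0, a]. *)
Lemma compact_sub_segment (S : set X) (x0 : kappa) : compact S ->
  exists a, S `<=` segment a.
Proof.
move=> cS.
(* the filter of sets containing all large elements, along which [segment]
   is increasing *)
pose F : set_system kappa := [set A | exists a, forall b, (a <= b)%O -> A b].
have FF : Filter F.
  split; first by exists x0.
    move=> A B [a aA] [b bB]; exists (Order.max a b) => c.
    by rewrite ge_max => /andP[ac bc]; split; [exact: aA|exact: bB].
  by move=> A B AB [a aA]; exists a => b /aA /AB.
have [a /(_ a (lexx _)) aS] : \near F, S `<=` segment F.
  move/compact_near_coveringP : cS; apply => x Sx.
  exists (segment x, [set b | (x <= b)%O]) => /=.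
    by split; [exact: segment_nbhs|exists x].
  by move=> [y b] /= [yx xb]; exact: le_trans xb.
by exists a.
Qed.

End ordinal_topology.

(** * Cofinality at most omega *)

Section cofinality_omega.
Context {kappa : ordnum}.
Local Notation X := (order_topology kappa).
Implicit Types a b c x y : kappa.

Lemma max_is_successor a : (forall x, (x <= a)%O) -> is_successor kappa.
Proof.
move=> amax; exists a; apply/seteqP; split => // x _.
by have := amax x; rewrite le_eqVlt => /predU1P[->|]; [right|left].
Qed.

Lemma cofinality_successor : is_successor kappa -> cofinality kappa = ordone.
Proof. by rewrite /cofinality; case: pselect. Qed.

Lemma cofinality_limit : ~ is_successor kappa ->
  cofinal_type kappa (cofinality kappa) /\
  forall alpha, cofinal_type kappa alpha -> ord_le (cofinality kappa) alpha.
Proof. by rewrite /cofinality; case: pselect => // *; case: cid. Qed.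

Lemma countable_cofinality_cover : ord_le (cofinality kappa) omega ->
  exists C : nat -> set X, (forall n, compact (C n)) /\
    forall x : X, exists n, nbhs x (C n).
Proof.
have [[a aE] _|nS [g [gm _]]] := pselect (is_successor kappa).
  exists (fun=> segment a); split => [_|x].
    exact: initial_segment_compact.
  exists 0; apply: segment_nbhs.
  have : [set: kappa] x by []; rewrite aE => -[/ltW|/= ->].
    by [].
  by [].
have [[A [Acof [f [fm fA]]]] _] := cofinality_limit nS.
have gi : injective g by apply: (inc_inj gm).
exists (fun n => [set x | exists2 i, g i = n & (x <= f i)%O]); split=> [n|x].
  have [[i gin]|ni] := pselect (exists i, g i = n).
    rewrite (_ : [set _ | _] = segment (f i));
      first exact: initial_segment_compact.
    apply/seteqP; split => [x [j gjn xj]|x xi]; last by exists i.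
    by rewrite (gi i j)// gin gjn.
  rewrite (_ : [set _ | _] = set0); first exact: compact0.
  by apply/seteqP; split => // x [i gin _]; apply: ni; exists i.
have [y Ay xy] := Acof x; move: Ay; rewrite -fA => -[i _ fiy].
exists (g i); apply: filterS (segment_nbhs (a := f i) (x := x) _) => [z zi|].
  by exists i.
by rewrite fiy.
Qed.

(** What uncountable cofinality means for sequences: an unbounded increasing
    sequence would be a cofinal subset of type omega. *)
Lemma uncountable_cofinality : ~ ord_le (cofinality kappa) omega ->
  [/\ exists x : kappa, True, forall a, exists b, (a < b)%O &
    forall s : nat -> kappa, (forall n, (s n < s n.+1)%O) ->
      exists b, forall n, (s n < b)%O].
Proof.
have [/cofinality_successor ->|nS nle] := pselect (is_successor kappa).
  (* a successor has cofinality 1, which embeds in omega *)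
  case; exists (fun=> 0); split.
    by move=> x y; rewrite (ord1 x) (ord1 y) !lexx.
  by move=> x b; rewrite lex0 => /eqP ->; exists ord0.
have [[A [Acof [f [fm fA]]]] amin] := cofinality_limit nS; split.
- apply: contrapT => k0; apply: nle; exists (fun=> 0); split.
    by move=> i; case: k0; exists (f i).
  by move=> i; case: k0; exists (f i).
- move=> a; apply: contrapT => na; apply/nS/(@max_is_successor a) => x.
  by rewrite leNgt; apply/negP => ax; apply: na; exists x.
- move=> s sm; apply: contrapT => ns; apply: nle; apply: amin.
  exists (range s); split.
    move=> x; apply: contrapT => nx; apply: ns; exists x => n.
    rewrite ltNge; apply/negP => xs; apply: nx; exists (s n) => //; by exists n.
  exists s; split => //.
  by apply: le_mono; apply: homo_ltn => // y x z; exact: lt_trans.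
Qed.

End cofinality_omega.

(** * Uncountable cofinality: C_k(kappa) is not Ascoli *)

Section not_ascoli.
Context {R : realType} {kappa : ordnum}.
Hypothesis no_max : forall a : kappa, exists b, (a < b)%O.
Hypothesis omega_bounded : forall s : nat -> kappa,
  (forall n, (s n < s n.+1)%O) -> exists b, forall n, (s n < b)%O.
Local Notation X := (order_topology kappa).
Implicit Types a b c x y : kappa.

Let succ_spec a : exists s, (a < s)%O /\ forall x, (x < s)%O = (x <= a)%O.
Proof. by have [s] := ord_succ_exists (no_max a); exists s. Qed.

Definition osucc a : kappa := projT1 (cid (succ_spec a)).

Lemma osucc_gt a : (a < osucc a)%O.
Proof. exact: (projT2 (cid (succ_spec a))).1. Qed.

Lemma lt_osucc x a : (x < osucc a)%O = (x <= a)%O.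
Proof. exact: (projT2 (cid (succ_spec a))).2. Qed.

Lemma osucc_le a b : (a < b)%O -> (osucc a <= b)%O.
Proof. by rewrite [(osucc a <= b)%O]leNgt lt_osucc -ltNge. Qed.

(** An infinite set that is finite below every point would have order type
    omega and be cofinal. *)
Lemma finite_of_finite_below (B : set kappa) :
  (forall b, finite_set (B `&` [set x | (x < b)%O])) -> finite_set B.
Proof.
move=> Bfin; apply: contrapT => Binf.
have /choice[next nextP] a : exists b, B b /\ (a < b)%O.
  apply: contrapT => na; apply: Binf.
  apply: sub_finite_set (Bfin (osucc a)) => x Bx; split => //=.
  by rewrite lt_osucc leNgt; apply/negP => ax; apply: na; exists x.
have [x0 _] : B !=set0 by apply/set0P/eqP => B0; apply: Binf; rewrite B0.
pose s n := iter n.+1 next x0.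
have sm n : (s n < s n.+1)%O by exact: (nextP _).2.
have si : injective s.
  apply: inc_inj; apply: le_mono; apply: homo_ltn => // y x z.
  exact: lt_trans.
have [b sb] := omega_bounded sm.
have : finite_set (s @^-1` (B `&` [set x | (x < b)%O])).
  by apply: finite_preimage (Bfin b) => m n _ _; exact: si.
rewrite (_ : s @^-1` _ = setT); first exact: infinite_nat.
by apply/seteqP; split => // n _; split; [exact: (nextP _).1|exact: sb].
Qed.

(** At the least b below which infinitely many jumps are large, these jumps
    a < a + 1 <= b accumulate, against the equicontinuity of Q at b. *)
Lemma large_jumps_finite (Q : set (Ck R X)) (e : R) : compact Q -> 0 < e ->
  finite_set [set a | exists2 f, Q f & e <= `|ckfun f (osucc a) - ckfun f a|].
Proof.
move=> cQ e0; set B := [set a | _]; apply: contrapT => Binf.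
have [b0 Bb0] : exists b, ~ finite_set (B `&` [set x | (x < b)%O]).
  apply: contrapT => /forallNP Bfin; apply: Binf.
  by apply: finite_of_finite_below => b; exact: contrapT.
have [b Bb bmin] := @ord_min kappa [set b | ~ _] (ex_intro _ b0 Bb0).
have e2 : 0 < e / 2 by lra.
have /nbhs_left_itv bQ := compact_Ck_equicontinuous cQ
  (initial_segment_compact (a := b)) (lexx b) e2.
have [a [Ba ab aQ]] : exists a, [/\ B a, (a < b)%O &
    forall y, (a <= y)%O -> (y <= b)%O ->
      forall f, Q f -> `|ckfun f y - ckfun f b| < e / 2].
  case: bQ => [bQ|[c cb cQ']].
    have [a [Ba ab]] : B `&` [set x | (x < b)%O] !=set0.
      by apply/set0P/eqP => B0; apply: Bb; rewrite B0.
    by exists a; split => // y _ yb; exact: bQ.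
  have [a [Ba ab ca]] : exists a, [/\ B a, (a < b)%O & (c < a)%O].
    apply: contrapT => na; apply: Bb.
    have fc : finite_set (B `&` [set x | (x < c)%O]).
      by apply: contrapT => /bmin; rewrite leNgt cb.
    apply: (@sub_finite_set _ _ (c |` (B `&` [set x | (x < c)%O]))).
      move=> x [Bx xb]; have [xc|cx|->] := ltgtP x c; [by right| |by left].
      by case: na; exists x.
    by rewrite finite_setU; split.
  exists a; split => // y ay yb; apply: cQ' => //; exact: lt_le_trans ay.
case: Ba => f Qf; apply/negP; rewrite -ltNge.
have := aQ _ (ltW (osucc_gt a)) (osucc_le ab) f Qf.
have := aQ _ (lexx a) (ltW ab) f Qf.
have := ler_distD (ckfun f b) (ckfun f (osucc a)) (ckfun f a).
rewrite (distrC (ckfun f b)); lra.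
Qed.

Lemma jump_continuous a :
  continuous (fun f : Ck R X => ckfun f (osucc a) - ckfun f a).
Proof.
move=> f; apply: cvgB; first exact: (@nbhs_filter (Ck R X)).
  exact: ckeval_continuous.
exact: ckeval_continuous.
Qed.

Definition jump a : Ck R (Ck R X) := mkcts (@jump_continuous a).

Lemma jumpE a f : ckfun (jump a) f = ckfun f (osucc a) - ckfun f a.
Proof. by []. Qed.

Definition zero_ck (Y : topologicalType) : Ck R Y :=
  mkcts (@cst_continuous Y R 0).

Lemma zero_ckE (Y : topologicalType) (y : Y) : ckfun (zero_ck Y) y = 0.
Proof. by []. Qed.

Definition jumps : set (Ck R (Ck R X)) := zero_ck (Ck R X) |` range jump.

Lemma jumps_compact : compact jumps.
Proof.
apply: (compact_almost_in_nbhs (y := zero_ck (Ck R X))); first by left.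
move=> U /nbhs_tube[Q [e [cQ e0 QU]]].
apply: sub_finite_set (finite_image jump (large_jumps_finite cQ e0)).
move=> _ [[->|[a _ <-]] nU].
  by case: nU; apply: QU => f _; rewrite subrr normr0.
exists a => //=; apply: contrapT => na; apply/nU/QU => f Qf.
rewrite ltNge; apply/negP => ef; apply: na; exists f => //.
by move: ef; rewrite jumpE zero_ckE subr0.
Qed.

Lemma step_continuous b :
  continuous (fun x : X => if (x <= b)%O then 0 else 1 : R).
Proof.
move=> x; apply: (@near_cst_continuous _ _ (if (x <= b)%O then 0 else 1 : R)).
have [xb|bx] := leP x b.
  by apply: filterS (segment_nbhs xb) => y /= ->.
have : nbhs (x : X) (~` segment b).
  apply: open_nbhs_nbhs; split.
    by rewrite openC; exact: (segment_clopen b).2.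
  by apply/negP; rewrite -ltNge.
by apply: filterS => y /negP/negbTE ->.
Qed.

Definition step b : Ck R X := mkcts (@step_continuous b).

Lemma stepE b x : ckfun (step b) x = if (x <= b)%O then 0 else 1.
Proof. by []. Qed.

(** For large b the pair (step b, jump b) lies in any prescribed neighbourhood
    of (0, 0), while jump b (step b) = 1. *)
Lemma jumps_not_evenly_continuous (x0 : kappa) : ~ evenly_continuous jumps.
Proof.
move=> ec.
have K0 : zero_ck (Ck R X) \in jumps by rewrite inE; left.
have := ec (zero_ck X, exist (fun f => f \in jumps) _ K0) (ball 0 1)
  (nbhsx_ballx _ _ ltr01).
case=> -[U V] /= [U0 [_ [[W oW <-] W0 WV]] UV].
have {U0} /nbhs_tube[S [r [cS r0 SU]]] := U0.
have /nbhs_tube[Q [e [cQ e0 QW]]] : nbhs (zero_ck (Ck R X)) W.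
  exact: open_nbhs_nbhs.
have [a Sa] := compact_sub_segment x0 cS.
have [c Bc] :=
  compact_sub_segment x0 (@finite_compact X _ (large_jumps_finite cQ e0)).
pose b := osucc (Order.max a c).
have ab : (a < b)%O by rewrite lt_osucc le_max lexx.
have cb : (c < b)%O by rewrite lt_osucc le_max lexx orbT.
have Kb : jump b \in jumps by rewrite inE; right; exists b.
have : ball (0 : R) 1 (ckfun (jump b) (step b)).
  apply: (UV (step b, exist (fun f => f \in jumps) _ Kb)); split => /=.
    apply: SU => x /Sa xa; rewrite stepE (le_trans xa (ltW ab)).
    by rewrite zero_ckE subr0 normr0.
  apply: WV => /=; apply: QW => f Qf; rewrite jumpE zero_ckE subr0.
  rewrite ltNge; apply/negP => ef.
  have : segment c b by apply: Bc; exists f.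
  by rewrite /segment /= leNgt cb.
rewrite jumpE !stepE lexx leNgt osucc_gt /ball /=.
by rewrite subr0 sub0r normrN normr1 ltxx.
Qed.

End not_ascoli.

Theorem theorem1p3 (R : realType) (kappa : ordnum) :
  (ascoli_space R (Ck R (order_topology kappa)) <->
   ord_le (cofinality kappa) omega) /\
  (ord_le (cofinality kappa) omega ->
   completely_metrizable R (Ck R (order_topology kappa))).
Proof.
have cm : ord_le (cofinality kappa) omega ->
    completely_metrizable R (Ck R (order_topology kappa)).
  move=> /countable_cofinality_cover[C [cC nC]].
  exact: Ck_completely_metrizable cC nC.
split=> //; split=> [[_ ac]|/cm[d [dm dt _]]]; last first.
  exact: metrizable_ascoli dm dt.
apply: contrapT => /uncountable_cofinality[[x0 _] no_max bounded].
apply: (jumps_not_evenly_continuous (R := R) (no_max := no_max) bounded x0).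
exact/ac/jumps_compact.
Qed.
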